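(* Let $X:\Omega\to\mathbb{C}^{N\times m}$ be a solution of the Grassmannian sigma model equations with associated surface $Z:\Omega\to\mathfrak{su}(N)$, let $\det G\neq0$ on a neighborhood $\Upsilon\subset\Omega$ of a point, and let $(\partial_L Z,\partial_R Z,n_3,\ldots,n_{N^2-1})$ be a smooth moving frame on $\Upsilon$ with $(\partial_L Z,n_k)=(\partial_R Z,n_k)=0$ and $(n_j,n_k)=\delta_{jk}$. Write its Gauss--Weingarten equations in matrix form as $$\partial_L\vec\tau=U\vec\tau,\qquad \partial_R\vec\tau=V\vec\tau,\qquad \vec\tau=(\partial_L Z,\partial_R Z,n_3,\ldots,n_{N^2-1})^T,$$ with $$U=\begin{pmatrix}A^L_L&A^L_R&Q^L_3&\cdots&Q^L_{N^2-1}\\0&0&H_3&\cdots&H_{N^2-1}\\ \alpha^L_3&\beta^L_3&s^L_{33}&\cdots&s^L_{3(N^2-1)}\\ \vdots&\vdots&\vdots&&\vdots\\ \alpha^L_{N^2-1}&\beta^L_{N^2-1}&s^L_{(N^2-1)3}&\cdots&s^L_{(N^2-1)(N^2-1)}\end{pmatrix},$$ $$V=\begin{pmatrix}0&0&H_3&\cdots&H_{N^2-1}\\ A^R_L&A^R_R&Q^R_3&\cdots&Q^R_{N^2-1}\\ \alpha^R_3&\beta^R_3&s^R_{33}&\cdots&s^R_{3(N^2-1)}\\ \vdots&\vdots&\vdots&&\vdots\\ \alpha^R_{N^2-1}&\beta^R_{N^2-1}&s^R_{(N^2-1)3}&\cdots&s^R_{(N^2-1)(N^2-1)}\end{pmatrix}.$$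 Then the Gauss--Codazzi--Ricci equations $$\partial_R U-\partial_L V+[U,V]=0$$ are identically satisfied on $\Upsilon$.
   Context: Let $m,n\ge 1$ and $N=m+n$. Let $\Omega\subset\mathbb{R}^2$ be open, connected and simply connected, with light-cone coordinates $\xi_L=\xi^0+\xi^1$, $\xi_R=\xi^0-\xi^1$, and write $\partial_L=\partial/\partial\xi_L$, $\partial_R=\partial/\partial\xi_R$. A dagger denotes the conjugate transpose. A smooth map $X:\Omega\to\mathbb{C}^{N\times m}$ with $X^\dagger X=\mathbf{1}_{m\times m}$ represents a map into the Grassmannian $G(m,n)=SU(N)/S(U(m)\times U(n))$. Put $P=\mathbf{1}-XX^\dagger$. $X$ is called a solution of the Grassmannian sigma model (Euler--Lagrange) equations if $[\partial_L\partial_R P,P]=0$ on $\Omega$, equivalently $\partial_L[\partial_R P,P]+\partial_R[\partial_L P,P]=0$. The algebra $\mathfrak{su}(N)$ of traceless anti-Hermitian $N\times N$ matrices is equipped with the scalar product $(A,B)=-\frac12\operatorname{tr}(AB)$. For a solution $X$, the associated surface is the smooth map $Z:\Omega\to\mathfrak{su}(N)$, unique up to an additive constant, with $\partial_L Z=[\partial_L P,P]$ and $\partial_R Z=-[\partial_R P,P]$. Put $J_D=(\partial_D Z,\partial_D Z)$ for $D=L,R$, $G_{LR}=(\partial_L Z,\partial_R Z)$, and $\det G=J_LJ_R-G_{LR}^2$. The entries of $U$ and $V$ are the real coefficient functions of the Gauss--Weingarten equations of the frame, i.e. of the expansions (summation over repeated lower-case indices from $3$ to $N^2-1$) $$\begin{aligned}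 \partial_L\partial_L Z&=A^L_L\partial_L Z+A^L_R\partial_R Z+Q^L_jn_j, & \partial_R\partial_R Z&=A^R_L\partial_L Z+A^R_R\partial_R Z+Q^R_jn_j,\\ \partial_L\partial_R Z&=\partial_R\partial_L Z=H_jn_j, & &\\ \partial_L n_j&=\alpha^L_j\partial_L Z+\beta^L_j\partial_R Z+s^L_{jk}n_k, & \partial_R n_j&=\alpha^R_j\partial_L Z+\beta^R_j\partial_R Z+s^R_{jk}n_k, \end{aligned}$$ which are valid for such a frame ($\partial_L\partial_R Z=[\partial_L P,\partial_R P]$ being normal to the surface). *)

(* Defs.v *)
From HB Require Import structures.
From mathcomp Require Import all_boot all_order all_algebra.
From mathcomp Require Import spectral.
From mathcomp Require Import complex.
From mathcomp Require Import boolp classical_sets functions reals.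
From mathcomp Require Import topology normedtype derive.

Set Implicit Arguments.
Unset Strict Implicit.
Unset Printing Implicit Defensive.

Import Order.TTheory GRing.Theory Num.Theory.
Import numFieldNormedType.Exports.

Local Open Scope classical_set_scope.
Local Open Scope ring_scope.
Local Open Scope complex_scope.
Local Open Scope sesquilinear_scope.

(* Points of the plane are rows (xi^0, xi^1). *)
Notation plane R := ('rV[R]_2).

(* Since xi^0 = (xi_L + xi_R) / 2 and xi^1 = (xi_L - xi_R) / 2, the partial
   derivatives with respect to the light-cone coordinates xi_L and xi_R are the
   derivatives along (1/2, 1/2) and (1/2, -1/2). *)
Definition eL (R : realType) : plane R := \row_(j < 2) 2^-1.
Definition eR (R : realType) : plane R :=
  \row_(j < 2) (if j == ord0 then 2^-1 else - 2^-1).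

(* The domains of smoothness below are always open. *)
Fixpoint Ck_on (R : realType) (W : normedModType R) (k : nat)
    (D : set (plane R)) (f : plane R -> W) : Prop :=
  match k with
  | 0 => forall p, D p -> {for p, continuous f}
  | k'.+1 => (forall p, D p -> differentiable f p) /\
             (forall v : plane R, Ck_on k' D (fun p => 'D_v f p))
  end.

Definition smooth_on (R : realType) (W : normedModType R)
    (D : set (plane R)) (f : plane R -> W) : Prop :=
  forall k, Ck_on k D f.

(* R[i] carries no normed R-module structure in the library, so that real
   differential calculus of complex matrices is done on the real and imaginary
   parts. *)
Definition mxRe (R : realType) (p q : nat) (A : 'M[R[i]]_(p, q)) : 'M[R]_(p, q) :=
  map_mx (@complex.Re R) A.
Definition mxIm (R : realType) (p q : nat) (A : 'M[R[i]]_(p, q)) : 'M[R]_(p, q) :=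
  map_mx (@complex.Im R) A.

Definition smoothC_on (R : realType) (p q : nat) (D : set (plane R))
    (F : plane R -> 'M[R[i]]_(p, q)) : Prop :=
  smooth_on D (fun x => mxRe (F x)) /\ smooth_on D (fun x => mxIm (F x)).

Definition derC (R : realType) (p q : nat) (v : plane R)
    (F : plane R -> 'M[R[i]]_(p, q)) (x : plane R) : 'M[R[i]]_(p, q) :=
  \matrix_(i, j) (('D_v (fun y => mxRe (F y)) x) i j +i*
                  ('D_v (fun y => mxIm (F y)) x) i j).

Definition dL (R : realType) (p q : nat) (F : plane R -> 'M[R[i]]_(p, q)) :=
  derC (eL R) F.
Definition dR (R : realType) (p q : nat) (F : plane R -> 'M[R[i]]_(p, q)) :=
  derC (eR R) F.

(* Every loop in D is contractible in D, with fixed base point; connectedness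
   of D is not included. *)
Definition simply_connected (R : realType) (D : set (plane R)) : Prop :=
  forall g : R -> plane R,
    {within `[0, 1], continuous g} -> (forall t, t \in `[0, 1] -> D (g t)) ->
    g 0 = g 1 ->
  exists h : R * R -> plane R,
    [/\ {within `[0, 1]%classic `*` `[0, 1]%classic, continuous h},
        forall s t, s \in `[0, 1] -> t \in `[0, 1] -> D (h (s, t)),
        forall t, t \in `[0, 1] -> h (0, t) = g t,
        forall t, t \in `[0, 1] -> h (1, t) = g 0 &
        forall s, s \in `[0, 1] -> h (s, 0) = g 0 /\ h (s, 1) = g 0].

Definition mxcomm (K : pzRingType) (N : nat) (A B : 'M[K]_N) : 'M[K]_N :=
  A *m B - B *m A.

Definition is_su (R : realType) (N : nat) (A : 'M[R[i]]_N) : Prop :=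
  A ^t* = - A /\ \tr A = 0.

(* Takes real values on su(N). *)
Definition su_dot (R : realType) (N : nat) (A B : 'M[R[i]]_N) : R[i] :=
  - 2^-1 * \tr (A *m B).

Definition proj_of (R : realType) (N m : nat)
    (X : plane R -> 'M[R[i]]_(N, m)) (p : plane R) : 'M[R[i]]_N :=
  1%:M - X p *m (X p) ^t*.

Definition sigma_solution (R : realType) (N m : nat) (Omega : set (plane R))
    (X : plane R -> 'M[R[i]]_(N, m)) : Prop :=
  [/\ smoothC_on Omega X,
      forall p, Omega p -> (X p) ^t* *m X p = 1%:M &
      forall p, Omega p ->
        mxcomm (dL (dR (proj_of X)) p) (proj_of X p) = 0].

Definition associated_surface (R : realType) (N m : nat) (Omega : set (plane R))
    (X : plane R -> 'M[R[i]]_(N, m)) (Z : plane R -> 'M[R[i]]_N) : Prop :=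
  [/\ smoothC_on Omega Z,
      forall p, Omega p -> is_su (Z p),
      forall p, Omega p -> dL Z p = mxcomm (dL (proj_of X) p) (proj_of X p) &
      forall p, Omega p -> dR Z p = - mxcomm (dR (proj_of X) p) (proj_of X p)].

Definition J_L (R : realType) (N : nat) (Z : plane R -> 'M[R[i]]_N) p : R[i] :=
  su_dot (dL Z p) (dL Z p).
Definition J_R (R : realType) (N : nat) (Z : plane R -> 'M[R[i]]_N) p : R[i] :=
  su_dot (dR Z p) (dR Z p).
Definition G_LR (R : realType) (N : nat) (Z : plane R -> 'M[R[i]]_N) p : R[i] :=
  su_dot (dL Z p) (dR Z p).
Definition detG (R : realType) (N : nat) (Z : plane R -> 'M[R[i]]_N) p : R[i] :=
  J_L Z p * J_R Z p - G_LR Z p ^+ 2.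

(* The normal n_j, 3 <= j <= N^2 - 1, is nv i with i = j - 3, so that k is to
   be N^2 - 3.  Where detG does not vanish these conditions make the k + 2
   vectors linearly independent, hence, by dimension, a basis of su(N). *)
Definition moving_frame (R : realType) (N k : nat) (Ups : set (plane R))
    (Z : plane R -> 'M[R[i]]_N) (nv : 'I_k -> plane R -> 'M[R[i]]_N) : Prop :=
  [/\ forall j, smoothC_on Ups (nv j),
      forall j p, Ups p -> is_su (nv j p),
      forall j p, Ups p -> su_dot (dL Z p) (nv j p) = 0,
      forall j p, Ups p -> su_dot (dR Z p) (nv j p) = 0 &
      forall i j p, Ups p -> su_dot (nv i p) (nv j p) = (i == j)%:R].

Definition tau (R : realType) (N k : nat) (Z : plane R -> 'M[R[i]]_N)
    (nv : 'I_k -> plane R -> 'M[R[i]]_N) (i : 'I_(1 + 1 + k)) :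
    plane R -> 'M[R[i]]_N :=
  match fintype.split i with
  | inl a => match fintype.split a with inl _ => dL Z | inr _ => dR Z end
  | inr j => nv j
  end.

(* A_DE is A^D_E; the families indexed by the normals are rows or columns
   according to their position in U and V. *)
Record gw_coeffs (R : realType) (k : nat) := GWCoeffs {
  A_LL : plane R -> R;
  A_LR : plane R -> R;
  A_RL : plane R -> R;
  A_RR : plane R -> R;
  Q_L : plane R -> 'rV[R]_k;
  Q_R : plane R -> 'rV[R]_k;
  H_ : plane R -> 'rV[R]_k;
  alpha_L : plane R -> 'cV[R]_k;
  beta_L : plane R -> 'cV[R]_k;
  s_L : plane R -> 'M[R]_k;
  alpha_R : plane R -> 'cV[R]_k;
  beta_R : plane R -> 'cV[R]_k;
  s_R : plane R -> 'M[R]_k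
}.

Definition U_mx (R : realType) (k : nat) (c : gw_coeffs R k) (p : plane R) :
    'M[R]_(1 + 1 + k) :=
  block_mx
    (block_mx (A_LL c p)%:M (A_LR c p)%:M
              0             0)             (col_mx (Q_L c p)
                                                   (H_ c p))
    (row_mx (alpha_L c p) (beta_L c p))    (s_L c p).

Definition V_mx (R : realType) (k : nat) (c : gw_coeffs R k) (p : plane R) :
    'M[R]_(1 + 1 + k) :=
  block_mx
    (block_mx 0             0
              (A_RL c p)%:M (A_RR c p)%:M) (col_mx (H_ c p)
                                                   (Q_R c p))
    (row_mx (alpha_R c p) (beta_R c p))    (s_R c p).

Definition gauss_weingarten (R : realType) (N k : nat) (Ups : set (plane R))
    (Z : plane R -> 'M[R[i]]_N) (nv : 'I_k -> plane R -> 'M[R[i]]_N)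
    (c : gw_coeffs R k) : Prop :=
  forall p, Ups p -> forall i : 'I_(1 + 1 + k),
    dL (tau Z nv i) p = \sum_j (U_mx c p i j)%:C *: tau Z nv j p /\
    dR (tau Z nv i) p = \sum_j (V_mx c p i j)%:C *: tau Z nv j p.

(* 'D_v is total in the library, so that existence of the two derivatives is
   asserted as well. *)
Definition gauss_codazzi_ricci (R : realType) (k : nat) (Ups : set (plane R))
    (c : gw_coeffs R k) : Prop :=
  forall p, Ups p ->
    [/\ derivable (U_mx c) p (eR R),
        derivable (V_mx c) p (eL R) &
        'D_(eR R) (U_mx c) p - 'D_(eL R) (V_mx c) p
          + mxcomm (U_mx c p) (V_mx c p) = 0].

(* Main.v *)
Require Import Defs.
From HB Require Import structures.
From mathcomp Require Import all_boot all_order all_algebra.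
From mathcomp Require Import spectral.
From mathcomp Require Import complex.
From mathcomp Require Import boolp classical_sets functions reals.
From mathcomp Require Import topology normedtype landau derive.
From mathcomp Require Import ring.

Import Order.TTheory GRing.Theory Num.Theory.
Import numFieldNormedType.Exports.

Local Open Scope classical_set_scope.
Local Open Scope ring_scope.
Local Open Scope complex_scope.

Set Implicit Arguments.
Unset Strict Implicit.
Unset Printing Implicit Defensive.
Local Open Scope sesquilinear_scope.

(* The frame (dL Z, dR Z, n_3, ..., n_(N^2-1)) has an invertible Gram matrix and N^2 - 1
   members, so it is a basis of su(N), and the matrices U and V are the unique
   coefficient matrices of its derivatives.  The Gauss-Codazzi-Ricci equations are
   then the equality of the mixed second derivatives of the frame, read off in that
   basis.  Uniqueness writes U and V as (matrix of scalar products) * (inverse Gram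
   matrix), whence their differentiability.  The zeros of U and V, and their common
   row H, come from dL (dR Z) = [dL P, dR P], which commutes with P and is therefore
   orthogonal to every [C, P], in particular to dL Z and dR Z. *)

(** * Directional derivatives of complex matrices *)

Section ComplexParts.
Variable R : pzRingType.
Implicit Types x y : R[i].

Lemma ReD x y : complex.Re (x + y) = complex.Re x + complex.Re y.
Proof. by case: x y => [a b] [c d]. Qed.

Lemma ImD x y : complex.Im (x + y) = complex.Im x + complex.Im y.
Proof. by case: x y => [a b] [c d]. Qed.

Lemma ReN x : complex.Re (- x) = - complex.Re x. Proof. by case: x. Qed.

Lemma ImN x : complex.Im (- x) = - complex.Im x. Proof. by case: x. Qed.

End ComplexParts.

Section ComplexParts2.
Variable R : rcfType.
Implicit Types x y : R[i].

Lemma ReM x y :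
  complex.Re (x * y) =
  complex.Re x * complex.Re y - complex.Im x * complex.Im y.
Proof. by case: x y => [a b] [c d]. Qed.

Lemma ImM x y :
  complex.Im (x * y) =
  complex.Re x * complex.Im y + complex.Im x * complex.Re y.
Proof. by case: x y => [a b] [c d]. Qed.

Lemma Re_conjC x : complex.Re (Num.conj x) = complex.Re x.
Proof. by case: x. Qed.

Lemma Im_conjC x : complex.Im (Num.conj x) = - complex.Im x.
Proof. by case: x. Qed.

Lemma eq_ReIm x y :
  complex.Re x = complex.Re y -> complex.Im x = complex.Im y -> x = y.
Proof. by case: x y => [a b] [c d] /= -> ->. Qed.

End ComplexParts2.

(** A relation rather than a value: it carries the existence of both real derivatives, so the
    calculus rules below need no separate derivability conditions. *)
Definition is_deriveC (R : realType) (x v : plane R) (f : plane R -> R[i])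
    (d : R[i]) : Prop :=
  is_derive x v (fun y => complex.Re (f y)) (complex.Re d) /\
  is_derive x v (fun y => complex.Im (f y)) (complex.Im d).

Section IsDeriveC.
Variables (R : realType) (x v : plane R).
Implicit Types (f g : plane R -> R[i]) (a b : R[i]).

Lemma is_deriveC_cst a : is_deriveC x v (fun=> a) 0.
Proof. by split; exact: is_derive_cst. Qed.

Lemma is_deriveCD f g a b : is_deriveC x v f a -> is_deriveC x v g b ->
  is_deriveC x v (fun y => f y + g y) (a + b).
Proof.
move=> [fr fi] [gr gi]; split.
  rewrite ReD (_ : (fun y => _) =
      (fun y => complex.Re (f y)) + (fun y => complex.Re (g y))).
    exact: is_deriveD.
  by apply/funext => y; rewrite ReD.
rewrite ImD (_ : (fun y => _) =
    (fun y => complex.Im (f y)) + (fun y => complex.Im (g y))).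
  exact: is_deriveD.
by apply/funext => y; rewrite ImD.
Qed.

Lemma is_deriveCN f a : is_deriveC x v f a -> is_deriveC x v (fun y => - f y) (- a).
Proof.
move=> [fr fi]; split.
  rewrite ReN (_ : (fun y => _) = - (fun y => complex.Re (f y))); first exact: is_deriveN.
  by apply/funext => y; rewrite ReN.
rewrite ImN (_ : (fun y => _) = - (fun y => complex.Im (f y))); first exact: is_deriveN.
by apply/funext => y; rewrite ImN.
Qed.

Lemma is_deriveCM f g a b : is_deriveC x v f a -> is_deriveC x v g b ->
  is_deriveC x v (fun y => f y * g y) (a * g x + f x * b).
Proof.
move=> [fr fi] [gr gi]; split.
  rewrite (_ : (fun y => _) =
      (fun y => complex.Re (f y)) * (fun y => complex.Re (g y)) -
      (fun y => complex.Im (f y)) * (fun y => complex.Im (g y))).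
    apply: is_derive_eq.
    by rewrite ReD !ReM /GRing.scale /=; ring.
  by apply/funext => y; rewrite ReM.
rewrite (_ : (fun y => _) =
    (fun y => complex.Re (f y)) * (fun y => complex.Im (g y)) +
    (fun y => complex.Im (f y)) * (fun y => complex.Re (g y))).
  apply: is_derive_eq.
  by rewrite ImD !ImM /GRing.scale /=; ring.
by apply/funext => y; rewrite ImM.
Qed.

Lemma is_deriveC_sum n (f : 'I_n -> plane R -> R[i]) (a : 'I_n -> R[i]) :
  (forall i, is_deriveC x v (f i) (a i)) ->
  is_deriveC x v (fun y => \sum_i f i y) (\sum_i a i).
Proof.
move=> fa; rewrite (_ : (fun y => _) = \sum_i f i); last first.
  by apply/funext => y; rewrite fct_sumE.
elim/big_ind2 : _ => [|g b h c gb hc|i _]; first exact: is_deriveC_cst.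
- exact: is_deriveCD.
- exact: fa.
Qed.

Lemma is_deriveC_conj f a :
  is_deriveC x v f a -> is_deriveC x v (fun y => Num.conj (f y)) (Num.conj a).
Proof.
move=> [fr fi]; split.
  rewrite Re_conjC (_ : (fun y => _) = (fun y => complex.Re (f y))) //.
  by apply/funext => y; rewrite Re_conjC.
rewrite Im_conjC (_ : (fun y => _) = - (fun y => complex.Im (f y))).
  exact: is_deriveN.
by apply/funext => y; rewrite Im_conjC.
Qed.

Lemma is_deriveC_real (f : plane R -> R) d :
  is_derive x v f d -> is_deriveC x v (fun y => (f y)%:C) d%:C.
Proof. by move=> fd; split=> //=; exact: is_derive_cst. Qed.

Lemma near_eq_is_deriveC f g a : (\near x, f x = g x) ->
  is_deriveC x v f a -> is_deriveC x v g a.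
Proof.
move=> fg [fr fi]; split.
  by apply: near_eq_is_derive fr; apply: filterS fg => y ->.
by apply: near_eq_is_derive fi; apply: filterS fg => y ->.
Qed.

Lemma is_deriveC_unique f a b : is_deriveC x v f a -> is_deriveC x v f b -> a = b.
Proof.
by move=> [[_ fr] [_ fi]] [[_ gr] [_ gi]]; apply: eq_ReIm; [rewrite -fr | rewrite -fi].
Qed.

End IsDeriveC.

Definition is_deriveCmx (R : realType) p q (x v : plane R)
    (F : plane R -> 'M[R[i]]_(p, q)) (D : 'M[R[i]]_(p, q)) : Prop :=
  forall i j, is_deriveC x v (fun y => F y i j) (D i j).

Section IsDeriveCmx.
Variables (R : realType) (x v : plane R).

Lemma is_deriveCmx_cst p q (A : 'M[R[i]]_(p, q)) : is_deriveCmx x v (fun=> A) 0.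
Proof. by move=> i j; rewrite mxE; exact: is_deriveC_cst. Qed.

Lemma is_deriveCmxD p q (F G : plane R -> 'M[R[i]]_(p, q)) A B :
  is_deriveCmx x v F A -> is_deriveCmx x v G B ->
  is_deriveCmx x v (fun y => F y + G y) (A + B).
Proof.
move=> FA GB i j; rewrite mxE (_ : (fun y => _) = (fun y => F y i j + G y i j)).
  exact: is_deriveCD.
by apply/funext => y; rewrite mxE.
Qed.

Lemma is_deriveCmxN p q (F : plane R -> 'M[R[i]]_(p, q)) A :
  is_deriveCmx x v F A -> is_deriveCmx x v (fun y => - F y) (- A).
Proof.
move=> FA i j; rewrite mxE (_ : (fun y => _) = (fun y => - F y i j)).
  exact: is_deriveCN.
by apply/funext => y; rewrite mxE.
Qed.

Lemma is_deriveCmxB p q (F G : plane R -> 'M[R[i]]_(p, q)) A B :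
  is_deriveCmx x v F A -> is_deriveCmx x v G B ->
  is_deriveCmx x v (fun y => F y - G y) (A - B).
Proof. by move=> FA GB; apply: is_deriveCmxD FA _; exact: is_deriveCmxN. Qed.

Lemma is_deriveCmxM p q r (F : plane R -> 'M[R[i]]_(p, q))
    (G : plane R -> 'M[R[i]]_(q, r)) A B :
  is_deriveCmx x v F A -> is_deriveCmx x v G B ->
  is_deriveCmx x v (fun y => F y *m G y) (A *m G x + F x *m B).
Proof.
move=> FA GB i j; rewrite !mxE -big_split /=.
rewrite (_ : (fun y => _) = (fun y => \sum_k F y i k * G y k j)).
  by apply: is_deriveC_sum => k; exact: is_deriveCM.
by apply/funext => y; rewrite mxE.
Qed.

Lemma is_deriveCmx_comm N (F G : plane R -> 'M[R[i]]_N) A B :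
  is_deriveCmx x v F A -> is_deriveCmx x v G B ->
  is_deriveCmx x v (fun y => mxcomm (F y) (G y))
    (mxcomm A (G x) + mxcomm (F x) B).
Proof.
move=> FA GB; rewrite /mxcomm addrACA -opprD [in X in _ - X]addrC.
by apply: is_deriveCmxB; exact: is_deriveCmxM.
Qed.

Lemma is_deriveCmx_adj p q (F : plane R -> 'M[R[i]]_(p, q)) A :
  is_deriveCmx x v F A -> is_deriveCmx x v (fun y => (F y) ^t*) (A ^t*).
Proof.
move=> FA i j; rewrite !mxE (_ : (fun y => _) = (fun y => Num.conj (F y j i))).
  exact: is_deriveC_conj.
by apply/funext => y; rewrite !mxE.
Qed.

Lemma is_deriveCmxZ p q (f : plane R -> R[i]) (F : plane R -> 'M[R[i]]_(p, q))
    a A : is_deriveC x v f a -> is_deriveCmx x v F A ->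
  is_deriveCmx x v (fun y => f y *: F y) (a *: F x + f x *: A).
Proof.
move=> fa FA i j; rewrite !mxE (_ : (fun y => _) = (fun y => f y * F y i j)).
  exact: is_deriveCM.
by apply/funext => y; rewrite mxE.
Qed.

Lemma is_deriveCmx_sum p q n (F : 'I_n -> plane R -> 'M[R[i]]_(p, q)) A :
  (forall k, is_deriveCmx x v (F k) (A k)) ->
  is_deriveCmx x v (fun y => \sum_k F k y) (\sum_k A k).
Proof.
move=> FA i j; rewrite summxE (_ : (fun y => _) = (fun y => \sum_k F k y i j)).
  by apply: is_deriveC_sum => k; exact: FA.
by apply/funext => y; rewrite summxE.
Qed.

Lemma is_deriveC_trace n (F : plane R -> 'M[R[i]]_n) A :
  is_deriveCmx x v F A -> is_deriveC x v (fun y => \tr (F y)) (\tr A).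
Proof. by move=> FA; apply: is_deriveC_sum => k; exact: FA. Qed.

Lemma near_eq_is_deriveCmx p q (F G : plane R -> 'M[R[i]]_(p, q)) A :
  (\near x, F x = G x) -> is_deriveCmx x v F A -> is_deriveCmx x v G A.
Proof.
by move=> FG FA i j; apply: near_eq_is_deriveC (FA i j); apply: filterS FG => y ->.
Qed.

Lemma is_deriveCmx_unique p q (F : plane R -> 'M[R[i]]_(p, q)) A B :
  is_deriveCmx x v F A -> is_deriveCmx x v F B -> A = B.
Proof.
by move=> FA FB; apply/matrixP => i j; exact: is_deriveC_unique (FA i j) (FB i j).
Qed.

(** [derC] is total, hence meaningful only where the derivative exists; this lemma and [derCP] pass
    between it and the relation. *)
Lemma derC_val p q (F : plane R -> 'M[R[i]]_(p, q)) A :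
  is_deriveCmx x v F A -> derC v F x = A.
Proof.
move=> FA; apply/matrixP => i j; have [[fr dr] [fi di]] := FA i j.
rewrite mxE !derive_mx ?mxE; last 2 first.
- apply/derivable_mxP => a b; have [_ [fi' _]] := FA a b.
  by rewrite (_ : (fun y => _) = (fun y => complex.Im (F y a b))) //;
    apply/funext => y; rewrite mxE.
- apply/derivable_mxP => a b; have [[fr' _] _] := FA a b.
  by rewrite (_ : (fun y => _) = (fun y => complex.Re (F y a b))) //;
    apply/funext => y; rewrite mxE.
apply: eq_ReIm => /=.
- by rewrite -dr; congr ('D_v _ x); apply/funext => y; rewrite mxE.
- by rewrite -di; congr ('D_v _ x); apply/funext => y; rewrite mxE.
Qed.

Lemma is_derive_entry p q (M : plane R -> 'M[R]_(p, q)) i j :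
  derivable M x v -> is_derive x v (fun y => M y i j) (('D_v M x) i j).
Proof.
move=> dM; apply: DeriveDef; first exact: (derivable_mxP _ _ _).1 dM i j.
by rewrite (derive_mx dM) mxE.
Qed.

Lemma derCP p q (F : plane R -> 'M[R[i]]_(p, q)) :
  derivable (fun y => mxRe (F y)) x v -> derivable (fun y => mxIm (F y)) x v ->
  is_deriveCmx x v F (derC v F x).
Proof.
move=> /is_derive_entry Fr /is_derive_entry Fi i j; rewrite /derC mxE; split.
  rewrite [X in is_derive _ _ X _](_ : _ = (fun y => mxRe (F y) i j)) ?Fr //.
  by apply/funext => y; rewrite mxE.
rewrite [X in is_derive _ _ X _](_ : _ = (fun y => mxIm (F y) i j)) ?Fi //.
by apply/funext => y; rewrite mxE.
Qed.

End IsDeriveCmx.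

(** * Symmetry of second derivatives *)

(** The two difference quotients agree as functions of the increment. This brings the derivative
    along v within reach of the one-variable mean value theorem. *)
Lemma is_derive_line (R : numFieldType) (V W : normedModType R) (f : V -> W)
    (q v : V) (t : R) (d : W) : is_derive (t *: v + q) v f d ->
  is_derive t 1 (fun s : R => f (s *: v + q)) d.
Proof.
have E : (fun h : R => h^-1 *: (((fun s : R => f (s *: v + q)) \o shift t)
             (h *: (1 : R)) - f (t *: v + q))) =
         (fun h => h^-1 *: ((f \o shift (t *: v + q)) (h *: v) - f (t *: v + q))).
  by apply/funext => h /=; rewrite [_ *: 1]mulr1 scalerDl addrA.
by move=> [dv <-]; apply: DeriveDef; rewrite /derivable /derive E.
Qed.

(** The second mixed difference of f over the parallelogram with sides h v and h w, divided by h
    squared. *)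
Definition diff_quot2 (R : realType) (V : normedModType R) (f : V -> R)
    (p v w : V) (h : R) : R :=
  h ^- 2 * (f (h *: v + (h *: w + p)) - f (h *: v + p) - f (h *: w + p) + f p).

Section Schwarz.
Variables (R : realType) (V : normedModType R) (p : V).
Implicit Types (f : V -> R) (v w : V).

Lemma diff_quot2C f v w : diff_quot2 f p v w = diff_quot2 f p w v.
Proof.
apply/funext => h; rewrite /diff_quot2 addrCA; congr (_ * (_ + _)).
by rewrite -!addrA; congr (_ + _); rewrite addrC.
Qed.

(* The mean value theorem along v turns the second difference quotient into
   a first difference quotient of g, the derivative of f along v, and
   differentiability of g at p controls the latter uniformly in the intermediate point. *)
Lemma cvg_diff_quot2 f g v w :
  (\forall y \near p, is_derive y v f (g y)) -> differentiable g p ->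
  diff_quot2 f p v w h @[h --> 0^'+] --> 'D_w g p.
Proof.
move=> /nbhs_ballP[r /= r0 fv] dg; rewrite deriveE //; apply/cvgrPdist_le => e e0.
(* The two remainders below are controlled by |c v + h w| + |c v|, at most h (2|v| + |w|); the
   summand 1 only makes K positive. *)
pose K := `|v| + `|v| + `|w| + 1.
have K0 : 0 < K by rewrite ltr_wpDl // !addr_ge0.
have /eqaddoP := diff_locally dg; move=> /(_ (e / K)).
move=> /(_ (divr_gt0 e0 K0)) /nbhs_ballP[d /= d0 gd].
have {}gd u : `|u| < d -> `|g (u + p) - g p - 'd g p u| <= e / K * `|u|.
  move=> ud; have := gd u; rewrite -ball_normE /= sub0r normrN => /(_ ud).
  by rewrite /= -[X in `|X|]/(g (u + p) - (g p + 'd g p u)) opprD addrA.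
near=> h.
have h0 : 0 < h by near: h; exact: nbhs_right_gt.
(* One bound serves twice: the parallelogram stays in the ball of radius r where f has derivative g
   along v, and displacements stay below d, where the first-order expansion of g holds. *)
have hm : h * K < Num.min r d.
  rewrite -ltr_pdivlMr //; near: h; apply: nbhs_right_lt.
  by rewrite divr_gt0 // lt_min r0.
have small t a : 0 <= t <= h -> 0 <= a <= h -> `|t *: v + a *: w| <= h * (`|v| + `|w|).
  move=> /andP[t0 th] /andP[a0 ah]; apply: le_trans (ler_normD _ _) _.
  by rewrite !normrZ !ger0_norm // mulrDr lerD // ler_wpM2r.
have vwK : `|v| + `|w| <= K.
  by rewrite /K -addrA -addrA lerD2l addrCA lerDl addr_ge0.
have near_p t a : 0 <= t <= h -> 0 <= a <= h -> ball p r (t *: v + (a *: w + p)).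
  move=> th ah; rewrite -ball_normE /= addrA opprD addrCA subrr addr0 normrN.
  apply: le_lt_trans (small _ _ th ah) _.
  apply: le_lt_trans (lt_le_trans hm _); last by rewrite ge_min lexx.
  by rewrite ler_wpM2l // ltW.
(* The second difference is [phi h - phi 0], to which the mean value theorem applies. *)
pose phi (s : R) := f (s *: v + (h *: w + p)) - f (s *: v + p).
have dphi t : 0 <= t <= h ->
    is_derive t 1 phi (g (t *: v + (h *: w + p)) - g (t *: v + p)).
  move=> th; apply: is_deriveB; apply: is_derive_line; apply: fv.
    by apply: near_p => //; rewrite ?lexx ltW.
  by have := near_p t 0 th; rewrite scale0r add0r; apply; rewrite ?lexx ltW.
have [c] : exists2 c, c \in `]0, h[%R & phi h - phi 0 =
    (g (c *: v + (h *: w + p)) - g (c *: v + p)) * (h - 0).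
  apply: (@MVT R phi (fun t => g (t *: v + (h *: w + p)) - g (t *: v + p)) _ _ h0).
    by move=> t; rewrite in_itv /= => /andP[t0 th]; apply: dphi; rewrite !ltW.
  apply: derivable_within_continuous => t; rewrite in_itv /= => th.
  by case: (dphi t th).
rewrite in_itv /= => /andP[c0 ch] phiE.
have ch' : 0 <= c <= h by rewrite !ltW.
have hd : h * (`|v| + `|w|) < d.
  apply: le_lt_trans (lt_le_trans hm _); last by rewrite ge_min lexx orbT.
  by rewrite ler_wpM2l // ltW.
have g1 := gd (c *: v + h *: w).
(* The null term in w lets the estimate [small] cover this displacement too. *)
have g2 := gd (c *: v + 0 *: w).
have hh : 0 <= h <= h by rewrite ?lexx ltW.
have h00 : 0 <= (0 : R) <= h by rewrite ?lexx ltW.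
have {}g1 := g1 (le_lt_trans (small _ _ ch' hh) hd).
have {}g2 := g2 (le_lt_trans (small _ _ ch' h00) hd).
rewrite scale0r addr0 in g2.
have -> : diff_quot2 f p v w h =
    h^-1 * (g (c *: v + (h *: w + p)) - g (c *: v + p)).
  have -> : diff_quot2 f p v w h = h ^- 2 * (phi h - phi 0).
    rewrite /diff_quot2 /phi scale0r !add0r; ring.
  by rewrite phiE subr0 expr2 invfM -mulrA [_ * h]mulrC mulKf // gt_eqF.
(* The terms linear in c v cancel, so the error is a difference of two first-order remainders of g
   at p. *)
have -> : 'd g p w - h^-1 * (g (c *: v + (h *: w + p)) - g (c *: v + p)) =
  - h^-1 * ((g (c *: v + h *: w + p) - g p - 'd g p (c *: v + h *: w)) -
           (g (c *: v + p) - g p - 'd g p (c *: v))).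
  rewrite !addrA linearD [ 'd g p (c *: v)]linearZ [ 'd g p (h *: w)]linearZ /=.
  rewrite -[h *: 'd g p w]/(h * 'd g p w).
  move: (g (c *: v + h *: w + p)) (g (c *: v + p)) (g p) ('d g p w) (c *: 'd g p v).
  move=> x1 x2 x3 x4 x5.
  by field; rewrite gt_eqF.
rewrite normrM normrN normfV (gtr0_norm h0) ler_pdivrMl //.
apply: le_trans (ler_normB _ _) _.
apply: le_trans (lerD g1 g2) _.
rewrite -mulrDr mulrAC ler_pdivrMr // -mulrA [leRHS]mulrCA ler_pM2l //.
apply: le_trans (lerD (ler_normD _ _) (lexx _)) _.
rewrite !normrZ (gtr0_norm h0) (gtr0_norm c0) /K.
have cv : c * `|v| <= h * `|v| by rewrite ler_wpM2r // ltW.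
apply: le_trans (_ : h * `|v| + h * `|w| + h * `|v| <= _).
  by rewrite !lerD.
by rewrite -!mulrDr ler_pM2l // [leLHS]addrAC lerDl.
Unshelve. all: by end_near. Qed.

(** Each side is the limit of [diff_quot2], which is symmetric in v and w; limits are unique. *)
Lemma schwarz f g1 g2 v w :
  (\forall y \near p, is_derive y v f (g1 y)) ->
  (\forall y \near p, is_derive y w f (g2 y)) ->
  differentiable g1 p -> differentiable g2 p -> 'D_w g1 p = 'D_v g2 p.
Proof.
move=> fv fw dg1 dg2; have cw := cvg_diff_quot2 (w := v) fw dg2.
have := cvg_diff_quot2 (w := w) fv dg1; rewrite diff_quot2C => cv.
exact: cvg_unique cv cw.
Qed.

End Schwarz.

(** * Smooth maps and commuting directional derivatives *)

Section Smooth.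
Variables (R : realType) (D : set (plane R)).

Lemma Ck_onS (W : normedModType R) k (E : set (plane R)) (f : plane R -> W) :
  E `<=` D -> Ck_on k D f -> Ck_on k E f.
Proof.
move=> ED; elim: k f => [f fc p Ep|k IH f [fd fk]]; first by apply: fc; exact: ED.
split=> [p Ep|v]; [by apply: fd; exact: ED | by apply: IH; exact: fk].
Qed.

Lemma smoothC_onS p q (E : set (plane R)) (F : plane R -> 'M[R[i]]_(p, q)) :
  E `<=` D -> smoothC_on D F -> smoothC_on E F.
Proof. by move=> ED [Fr Fi]; split=> k; apply: Ck_onS ED _. Qed.

Lemma smooth_on_derive (W : normedModType R) (f : plane R -> W) v :
  smooth_on D f -> smooth_on D (fun x => 'D_v f x).
Proof. by move=> fs k; have [_ fk] := fs k.+1; exact: fk. Qed.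

Lemma smooth_on_differentiable (W : normedModType R) (f : plane R -> W) x :
  smooth_on D f -> D x -> differentiable f x.
Proof. by move=> fs; have [fd _] := fs 1%N; exact: fd. Qed.

Lemma mxRe_derC p q (F : plane R -> 'M[R[i]]_(p, q)) v :
  (fun x => mxRe (derC v F x)) = (fun x => 'D_v (fun y => mxRe (F y)) x).
Proof. by apply/funext => x; apply/matrixP => i j; rewrite !mxE. Qed.

Lemma mxIm_derC p q (F : plane R -> 'M[R[i]]_(p, q)) v :
  (fun x => mxIm (derC v F x)) = (fun x => 'D_v (fun y => mxIm (F y)) x).
Proof. by apply/funext => x; apply/matrixP => i j; rewrite !mxE. Qed.

Lemma smoothC_on_derC p q (F : plane R -> 'M[R[i]]_(p, q)) v :
  smoothC_on D F -> smoothC_on D (derC v F).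
Proof.
by move=> [Fr Fi]; split; rewrite ?mxRe_derC ?mxIm_derC; exact: smooth_on_derive.
Qed.

Lemma smoothC_on_is_derive p q (F : plane R -> 'M[R[i]]_(p, q)) v x :
  smoothC_on D F -> D x -> is_deriveCmx x v F (derC v F x).
Proof.
move=> [Fr Fi] Dx.
by apply: derCP; apply: diff_derivable; exact: smooth_on_differentiable Dx.
Qed.

Hypothesis openD : open D.

Lemma derive_mxC p q (M : plane R -> 'M[R]_(p, q)) v w x :
  smooth_on D M -> D x ->
  'D_w (fun y => 'D_v M y) x = 'D_v (fun y => 'D_w M y) x.
Proof.
move=> Ms Dx; apply/matrixP => i j.
have dM u y : D y -> derivable (fun z => 'D_u M z) y u.
  by move=> Dy; apply/diff_derivable/smooth_on_differentiable/Dy/smooth_on_derive.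
have dE u y : D y -> is_derive y u (fun z => M z i j) (('D_u M y) i j).
  move=> Dy; apply: is_derive_entry; apply: diff_derivable.
  exact: smooth_on_differentiable Dy.
have cE u : differentiable (fun y => ('D_u M y) i j) x.
  apply: (@differentiable_comp _ _ _ _ (fun y => 'D_u M y)
    (fun N : 'M[R]_(p, q) => N i j)).
    by apply: smooth_on_differentiable Dx; exact: smooth_on_derive.
  exact: differentiable_coord.
have DD u1 u2 : ('D_u2 (fun y => 'D_u1 M y) x) i j = 'D_u2 (fun y => ('D_u1 M y) i j) x.
  have dd : derivable (fun y => 'D_u1 M y) x u2.
    by apply/diff_derivable/smooth_on_differentiable/Dx/smooth_on_derive.
  by have [_ ->] := is_derive_entry i j dd.
have nD : \forall y \near x, D y by exact: open_nbhs_nbhs.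
apply: etrans (DD v w) (etrans _ (esym (DD w v))).
apply: (schwarz (f := fun z => M z i j)) => //; last first.
  by apply: filterS nD => y; exact: dE.
by apply: filterS nD => y; exact: dE.
Qed.

Lemma derC_commute p q (F : plane R -> 'M[R[i]]_(p, q)) v w x :
  smoothC_on D F -> D x -> derC w (derC v F) x = derC v (derC w F) x.
Proof.
move=> [Fr Fi] Dx.
pose C (A B : 'M[R]_(p, q)) := \matrix_(i, j) (A i j +i* B i j).
have E u1 u2 : derC u2 (derC u1 F) x =
    C ('D_u2 (fun y => 'D_u1 (fun z => mxRe (F z)) y) x)
      ('D_u2 (fun y => 'D_u1 (fun z => mxIm (F z)) y) x).
  by rewrite [LHS]/derC mxRe_derC mxIm_derC.
have hr := derive_mxC v w Fr Dx; have hi := derive_mxC v w Fi Dx.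
rewrite (E v w) (E w v).
exact (f_equal2 C hr hi).
Qed.

End Smooth.

(** * Frames of su(N) *)

Section SuDot.
Variables (R : realType) (N : nat).
Implicit Types A B C : 'M[R[i]]_N.

Lemma su_dotC A B : su_dot A B = su_dot B A.
Proof. by rewrite /su_dot mxtrace_mulC. Qed.

Lemma su_dot_suml n (c : 'I_n -> R[i]) (t : 'I_n -> 'M[R[i]]_N) B :
  su_dot (\sum_j c j *: t j) B = \sum_j c j * su_dot (t j) B.
Proof.
rewrite /su_dot mulmx_suml raddf_sum mulr_sumr.
by apply: eq_bigr => j _; rewrite -scalemxAl /= mxtraceZ mulrCA.
Qed.

Lemma mxtrace_adj A : \tr (A ^t*) = Num.conj (\tr A).
Proof. by rewrite rmorph_sum; apply: eq_bigr => i _; rewrite !mxE. Qed.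

(** For anti-Hermitian A and B, the conjugate of tr(AB) is tr(B^† A^†) = tr(BA) = tr(AB). *)
Lemma su_dot_real A B :
  is_su A -> is_su B -> su_dot A B = (complex.Re (su_dot A B))%:C.
Proof.
move=> [hA _] [hB _]; rewrite RRe_real // /su_dot.
apply: realM; first by rewrite realN realV; exact: realn.
apply/CrealP; rewrite -mxtrace_adj trmx_mul map_mxM hA hB mulNmx mulmxN opprK.
by rewrite mxtrace_mulC.
Qed.

End SuDot.

Section SpecialUnitaryFrame.
Variables (R : realType) (N d : nat) (t : 'I_d -> 'M[R[i]]_N).
Hypothesis dE : (d + 1 = N * N)%N.
Hypothesis t_su : forall j, is_su (t j).

(** On su(N) the scalar products are real, so taking real parts loses nothing and the coordinates
    below come out real. *)
Definition gram : 'M[R]_d := \matrix_(i, j) complex.Re (su_dot (t i) (t j)).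

Definition dot_row (W : 'M[R[i]]_N) : 'rV[R]_d :=
  \row_j complex.Re (su_dot W (t j)).

Hypothesis gram_unit : gram \in unitmx.

Let gramC : 'M[R[i]]_d := \matrix_(i, j) su_dot (t i) (t j).

Let gramCE : gramC = map_mx (real_complex R) gram.
Proof. by apply/matrixP => i j; rewrite !mxE su_dot_real. Qed.

Let gramC_unit : gramC \in unitmx.
Proof. by rewrite gramCE map_unitmx. Qed.

Let dot_sum (c : 'rV[R[i]]_d) :
  \row_j su_dot (\sum_k c 0 k *: t k) (t j) = c *m gramC.
Proof.
apply/rowP => j; rewrite !mxE su_dot_suml.
by apply: eq_bigr => k _; rewrite mxE.
Qed.

(** Pairing a linear relation with every frame vector gives c times the complex Gram matrix, which
    is invertible. *)
Lemma frame_free (c : 'rV[R[i]]_d) : \sum_k c 0 k *: t k = 0 -> c = 0.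
Proof.
move=> c0; apply: (can_inj (mulmxK gramC_unit)).
rewrite mul0mx -dot_sum c0; apply/rowP => j.
by rewrite !mxE /su_dot mul0mx raddf0 mulr0.
Qed.

Let N_gt0 : (0 < N)%N.
Proof. by case: N dE => //; rewrite addn1. Qed.

(* The frame together with the identity matrix is free, hence spans 'M_N. *)
Lemma frame_span (W : 'M[R[i]]_N) :
  \tr W = 0 -> exists c : 'rV[R[i]]_d, W = \sum_k c 0 k *: t k.
Proof.
pose T := col_mx (\matrix_k mxvec (t k)) (mxvec (1%:M : 'M[R[i]]_N)).
have TE (c : 'rV[R[i]]_d) (a : 'M[R[i]]_1) :
    row_mx c a *m T = mxvec (\sum_k c 0 k *: t k + a 0 0 *: 1%:M).
  rewrite mul_row_col mulmx_sum_row linearD linear_sum /=; congr (_ + _).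
    by apply: eq_bigr => k _; rewrite rowK linearZ.
  by rewrite [a in LHS]mx11_scalar mul_scalar_mx linearZ.
(* The frame is traceless, so the trace isolates the coefficient of the identity matrix. *)
have tr_comb (u : 'rV[R[i]]_d) (b : R[i]) :
    \tr (\sum_k u 0 k *: t k + b *: (1%:M : 'M[R[i]]_N)) = b * N%:R.
  rewrite mxtraceD mxtraceZ mxtrace1 raddf_sum big1 ?add0r // => k _.
  by rewrite /= mxtraceZ (t_su k).2 mulr0.
have N0 : (N%:R : R[i]) != 0 by rewrite pnatr_eq0 -lt0n.
have Tfree : row_free T.
  apply: inj_row_free => v; rewrite -[v]hsubmxK TE.
  set c := lsubmx v; set a := rsubmx v => /(canRL mxvecK); rewrite linear0 => e.
  have a0 : a 0 0 = 0.
    have := tr_comb c (a 0 0); rewrite e raddf0 => /esym/eqP.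
    by rewrite mulf_eq0 (negPf N0) orbF => /eqP.
  move: e; rewrite a0 scale0r addr0 => /frame_free ->.
  by rewrite [a]mx11_scalar a0 raddf0 row_mx0.
(* By [dE] the d + 1 independent rows are as many as the dimension of the matrix space. *)
have Tfull : row_full T.
  by move: Tfree; rewrite /row_free /row_full => /eqP ->; rewrite dE.
move=> W0; have /submxP[v vE] := submx_full (mxvec W) Tfull.
move: vE; rewrite -[v]hsubmxK TE => /(can_inj mxvecK) WE.
exists (lsubmx v); move: W0; rewrite {1}WE tr_comb => /eqP.
rewrite mulf_eq0 (negPf N0) orbF => /eqP a0.
by rewrite [LHS]WE a0 scale0r addr0.
Qed.

(** The complex coefficients given by [frame_span] are real: they solve a linear system whose matrix
    [gram] and right-hand side [dot_row W] are both real. *)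
Lemma frame_coord (W : 'M[R[i]]_N) : is_su W ->
  W = \sum_j ((dot_row W *m invmx gram) 0 j)%:C *: t j.
Proof.
move=> suW; have [c cE] := frame_span suW.2.
have bE : c *m gramC = map_mx (real_complex R) (dot_row W).
  by rewrite -dot_sum -cE; apply/rowP => j; rewrite !mxE su_dot_real.
rewrite [LHS]cE; apply: eq_bigr => j _; congr (_ *: _).
by rewrite -[c](mulmxK gramC_unit) bE gramCE -map_invmx -map_mxM mxE.
Qed.

(** Pairing the expansion with the frame turns it into the system x * [gram] = [dot_row W]. *)
Lemma frame_coord_unique (W : 'M[R[i]]_N) (x : 'rV[R]_d) :
  W = \sum_j (x 0 j)%:C *: t j -> x = dot_row W *m invmx gram.
Proof.
move=> WE; apply: (canRL (mulmxK gram_unit)).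
apply/rowP => j; rewrite [RHS]mxE WE.
have := congr1 (fun v : 'rV_d => complex.Re (v 0 j))
  (dot_sum (map_mx (real_complex R) x)).
rewrite gramCE -map_mxM [in RHS]mxE /= => <-; rewrite mxE.
by congr (complex.Re (su_dot _ _)); apply: eq_bigr => k _; rewrite mxE.
Qed.

End SpecialUnitaryFrame.

(** * Differentiability of matrix products, determinants and inverses *)

Section DerivableMatrix.
Variables (R : realType) (V : normedModType R) (x v : V).

Lemma derivable_bigsum (I : Type) (r : seq I) (Q : pred I) (f : I -> V -> R) :
  (forall i, derivable (f i) x v) ->
  derivable (fun y => \sum_(i <- r | Q i) f i y) x v.
Proof.
move=> df; elim: r => [|i r IH].
  rewrite (_ : (fun y => _) = cst 0); first exact: derivable_cst.
  by apply/funext => y; rewrite big_nil.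
rewrite (_ : (fun y => _) =
    (fun y => (if Q i then f i y else 0) + \sum_(j <- r | Q j) f j y)).
  apply: derivableD IH; case: (Q i); [exact: df | exact: derivable_cst].
by apply/funext => y; rewrite big_cons; case: (Q i); rewrite ?add0r.
Qed.

Lemma derivable_bigprod (I : Type) (r : seq I) (Q : pred I) (f : I -> V -> R) :
  (forall i, derivable (f i) x v) ->
  derivable (fun y => \prod_(i <- r | Q i) f i y) x v.
Proof.
move=> df; elim: r => [|i r IH].
  rewrite (_ : (fun y => _) = cst 1); first exact: derivable_cst.
  by apply/funext => y; rewrite big_nil.
rewrite (_ : (fun y => _) =
    (fun y => (if Q i then f i y else 1) * \prod_(j <- r | Q j) f j y)).
  apply: derivableM IH; case: (Q i); [exact: df | exact: derivable_cst].
by apply/funext => y; rewrite big_cons; case: (Q i); rewrite ?mul1r.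
Qed.

Lemma derivable_mulmx m n p (A : V -> 'M[R]_(m, n)) (B : V -> 'M[R]_(n, p)) :
  derivable A x v -> derivable B x v -> derivable (fun y => A y *m B y) x v.
Proof.
move=> /derivable_mxP dA /derivable_mxP dB; apply/derivable_mxP => i j.
rewrite (_ : (fun y => _) = (fun y => \sum_k A y i k * B y k j)).
  by apply: derivable_bigsum => k; exact: derivableM.
by apply/funext => y; rewrite mxE.
Qed.

Lemma derivable_det n (A : V -> 'M[R]_n) :
  derivable A x v -> derivable (fun y => \det (A y)) x v.
Proof.
move=> /derivable_mxP dA; apply: derivable_bigsum => s.
by apply: derivableM; [exact: derivable_cst | exact: derivable_bigprod].
Qed.

(** By Cramer's rule the inverse is the adjugate over the determinant. [invmx] obeys this formula
    only on invertible matrices, hence the condition on a whole neighborhood. *)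
Lemma derivable_invmx n (A : V -> 'M[R]_n) :
  (\forall y \near x, A y \in unitmx) -> derivable A x v ->
  derivable (fun y => invmx (A y)) x v.
Proof.
move=> uA dA; have uAx := nbhs_singleton uA.
apply: (@near_eq_derivable _ _ _ (fun y => (\det (A y))^-1 *: \adj (A y))).
  by apply: filterS uA => y; rewrite /invmx => ->.
apply/derivable_mxP => i j.
rewrite (_ : (fun y => _) = (fun y => (\det (A y))^-1 * cofactor (A y) j i)).
  apply: derivableM.
    by apply: derivableV; [rewrite -unitfE -unitmxE | exact: derivable_det].
  apply: derivableM; first exact: derivable_cst.
  apply: derivable_det; apply/derivable_mxP => a b.
  rewrite (_ : (fun y => _) = (fun y => A y (lift j a) (lift i b))).
    by move/derivable_mxP: dA.
  by apply/funext => y; rewrite !mxE.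
by apply/funext => y; rewrite !mxE.
Qed.

End DerivableMatrix.

(** The conditions defining su(N) are real-linear: differentiate both identities and use uniqueness
    of derivatives. *)
Lemma is_su_derive (R : realType) N (F : plane R -> 'M[R[i]]_N) A x v :
  (\forall y \near x, is_su (F y)) -> is_deriveCmx x v F A -> is_su A.
Proof.
move=> suF dF; split.
  apply: is_deriveCmx_unique (is_deriveCmx_adj dF) _.
  by apply: near_eq_is_deriveCmx (is_deriveCmxN dF); apply: filterS suF => y [].
apply: is_deriveC_unique (is_deriveC_trace dF) _.
by apply: near_eq_is_deriveC (is_deriveC_cst x v 0); apply: filterS suF => y [].
Qed.

Lemma derivable_su_dot (R : realType) N (F G : plane R -> 'M[R[i]]_N) A B x v :
  is_deriveCmx x v F A -> is_deriveCmx x v G B ->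
  derivable (fun y => complex.Re (su_dot (F y) (G y))) x v.
Proof.
move=> dF dG.
have [[d _] _] := is_deriveCM (is_deriveC_cst x v (- 2^-1))
  (is_deriveC_trace (is_deriveCmxM dF dG)).
exact: d.
Qed.

(** * Connection matrices of a smooth frame and their flatness *)

Section FrameCompatibility.
Variables (R : realType) (N d : nat) (D : set (plane R)).
Variables (t : 'I_d -> plane R -> 'M[R[i]]_N).
Hypothesis dE : (d + 1 = N * N)%N.
Hypothesis openD : open D.
Hypothesis t_smooth : forall j, smoothC_on D (t j).
Hypothesis t_su : forall j p, D p -> is_su (t j p).
Hypothesis gram_unit : forall p, D p -> gram (fun j => t j p) \in unitmx.

Let nearD p : D p -> \forall y \near p, D y.
Proof. by move=> Dp; exact: open_nbhs_nbhs. Qed.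

Let t_derive v j p : D p -> is_deriveCmx p v (t j) (derC v (t j) p).
Proof. by move=> Dp; exact: smoothC_on_is_derive (t_smooth j) Dp. Qed.

Lemma derC_frame_su v j p : D p -> is_su (derC v (t j) p).
Proof.
move=> Dp; apply: is_su_derive (t_derive v j Dp).
by apply: filterS (nearD Dp) => y; exact: t_su.
Qed.

(** Row i holds the coordinates of the derivative of [t i] along v; the closed formula, in place of
    a choice of coordinates, exhibits its smooth dependence on p. *)
Definition connection (v : plane R) (p : plane R) : 'M[R]_d :=
  (\matrix_i dot_row (fun j => t j p) (derC v (t i) p)) *m
  invmx (gram (fun j => t j p)).

Let connection_row v p i :
  row i (connection v p) = dot_row (fun j => t j p) (derC v (t i) p) *m
    invmx (gram (fun j => t j p)).
Proof. by rewrite row_mul rowK. Qed.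

Lemma derC_frame v i p : D p ->
  derC v (t i) p = \sum_j (connection v p i j)%:C *: t j p.
Proof.
move=> Dp; rewrite [LHS](@frame_coord _ _ _ (fun j => t j p)) //.
- by rewrite -connection_row; apply: eq_bigr => j _; rewrite mxE.
- by move=> j; exact: t_su.
- exact: gram_unit.
- exact: derC_frame_su.
Qed.

Lemma connection_unique v p (U : 'M[R]_d) : D p ->
  (forall i, derC v (t i) p = \sum_j (U i j)%:C *: t j p) ->
  U = connection v p.
Proof.
move=> Dp UE; apply/row_matrixP => i; rewrite connection_row.
apply: frame_coord_unique; first by move=> j; exact: t_su.
- exact: gram_unit.
- by rewrite UE; apply: eq_bigr => j _; rewrite mxE.
Qed.

Lemma derivable_connection v w p : D p -> derivable (connection v) p w.
Proof.
move=> Dp; apply: derivable_mulmx.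
  apply/derivable_mxP => i j.
  rewrite (_ : (fun y => _) =
    (fun y => complex.Re (su_dot (derC v (t i) y) (t j y)))).
    apply: derivable_su_dot (t_derive w j Dp).
    exact: smoothC_on_is_derive (smoothC_on_derC v (t_smooth i)) Dp.
  by apply/funext => y; rewrite !mxE.
apply: derivable_invmx; first by apply: filterS (nearD Dp) => y; exact: gram_unit.
apply/derivable_mxP => i j.
rewrite (_ : (fun y => _) = (fun y => complex.Re (su_dot (t i y) (t j y)))).
  exact: derivable_su_dot (t_derive w i Dp) (t_derive w j Dp).
by apply/funext => y; rewrite !mxE.
Qed.

Let derive2_frame v w i p : D p ->
  derC w (derC v (t i)) p =
  \sum_j (('D_w (connection v) p + connection v p *m connection w p) i j)%:C *: t j p.
Proof.
move=> Dp; have dC : derivable (connection v) p w by exact: derivable_connection.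
have dd : is_deriveCmx p w (derC v (t i))
    (\sum_j ((('D_w (connection v) p) i j)%:C *: t j p +
             (connection v p i j)%:C *: derC w (t j) p)).
  apply: (@near_eq_is_deriveCmx _ _ _ _ _
      (fun y => \sum_j (connection v y i j)%:C *: t j y)).
    by apply: filterS (nearD Dp) => y Dy; rewrite derC_frame.
  apply: is_deriveCmx_sum => j; apply: is_deriveCmxZ (t_derive w j Dp).
  by apply: is_deriveC_real; exact: is_derive_entry.
(* Expanding the derivatives of the frame once more and exchanging the sums produces the matrix
   product of the two connections. *)
rewrite (derC_val dd) big_split /=.
rewrite [X in _ + X](eq_bigr (fun k => \sum_j
  ((connection v p i k)%:C * (connection w p k j)%:C) *: t j p)); last first.
  move=> k _; rewrite derC_frame // scaler_sumr.
  by apply: eq_bigr => j _; rewrite scalerA.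
rewrite exchange_big /= -big_split /=; apply: eq_bigr => j _.
rewrite -scaler_suml -scalerDl; congr (_ *: _).
rewrite [in RHS]mxE [in RHS]mxE rmorphD rmorph_sum /=; congr (_ + _).
by apply: eq_bigr => k _; rewrite rmorphM.
Qed.

Let frame_comb_inj p (A B : 'M[R]_d) i : D p ->
  \sum_j (A i j)%:C *: t j p = \sum_j (B i j)%:C *: t j p ->
  row i A = row i B.
Proof.
move=> Dp AB; pose x : 'rV[R]_d := row i (A - B).
have : map_mx (real_complex R) x = 0.
  apply: (@frame_free _ _ _ (fun j => t j p)) => //.
  - by move=> j; exact: t_su.
  - exact: gram_unit.
  move/eqP: AB; rewrite -subr_eq0 -sumrB => /eqP AB.
  rewrite -[RHS]AB; apply: eq_bigr => j _.
  by rewrite -scalerBl -rmorphB !mxE.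
move=> e; apply/eqP; rewrite -subr_eq0 -raddfB -/x; apply/eqP/rowP => j.
by have /rowP/(_ j) := e; rewrite !mxE => /eqP; rewrite fmorph_eq0 => /eqP.
Qed.

Lemma connection_flat v w p : D p ->
  'D_w (connection v) p - 'D_v (connection w) p
    + mxcomm (connection v p) (connection w p) = 0.
Proof.
(* Regrouped, the claim equates the coefficient matrices of the second derivatives taken in the two
   orders. *)
move=> Dp; rewrite /mxcomm addrACA -opprD; apply/eqP; rewrite subr_eq0.
apply/eqP/row_matrixP => i; apply: (frame_comb_inj Dp).
apply: etrans (esym (derive2_frame v w i Dp)) (etrans _ (derive2_frame w v i Dp)).
exact: derC_commute (t_smooth i) Dp.
Qed.

End FrameCompatibility.

(** * The surface of a sigma model solution *)

(** The hypotheses say that moving P across A or B turns it into 1 - P; crossing both restores P. *)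
Lemma projection_comm (K : pzRingType) N (P A B : 'M[K]_N) :
  A *m P + P *m A = A -> B *m P + P *m B = B ->
  P *m (A *m B) = (A *m B) *m P.
Proof.
move=> hA hB; have PB : P *m B = B - B *m P by rewrite -[X in X - _]hB addrC addKr.
have PA : P *m A = A - A *m P by rewrite -[X in X - _]hA addrC addKr.
by rewrite mulmxA PA mulmxBl -!mulmxA PB mulmxBr opprB addrCA subrr addr0.
Qed.

Lemma su_dotNr (R : realType) N (A B : 'M[R[i]]_N) :
  su_dot A (- B) = - su_dot A B.
Proof. by rewrite /su_dot mulmxN raddfN mulrN. Qed.

(* [A, B] commutes with P, so the two terms of tr([A, B] [C, P]) cancel. *)
Lemma su_dot_comm_projection (R : realType) N (P A B C : 'M[R[i]]_N) :
  A *m P + P *m A = A -> B *m P + P *m B = B ->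
  su_dot (mxcomm A B) (mxcomm C P) = 0.
Proof.
move=> hA hB; have MP : mxcomm A B *m P = P *m mxcomm A B.
  by rewrite /mxcomm mulmxBl mulmxBr !(projection_comm hA, projection_comm hB).
rewrite /su_dot; set M := mxcomm A B in MP *.
rewrite /mxcomm mulmxBr raddfB /= [M *m (P *m C)]mulmxA MP -mulmxA.
by rewrite [\tr (P *m _)]mxtrace_mulC mulmxA subrr mulr0.
Qed.

Section SigmaModel.
Variables (R : realType) (N m : nat) (Omega : set (plane R)).
Variables (X : plane R -> 'M[R[i]]_(N, m)) (Z : plane R -> 'M[R[i]]_N).
Hypotheses (openO : open Omega) (solX : sigma_solution Omega X).
Hypothesis surfZ : associated_surface Omega X Z.
Local Notation P := (proj_of X).

Let nearO p : Omega p -> \forall y \near p, Omega y.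
Proof. by move=> Op; exact: open_nbhs_nbhs. Qed.

Let derX v p : Omega p -> is_deriveCmx p v X (derC v X p).
Proof. by move=> Op; case: solX => sX _ _; exact: smoothC_on_is_derive sX Op. Qed.

(** The product rule for 1 - X X^†: the derivatives of P are obtained from the smoothness of X. *)
Let dP v p := - (derC v X p *m (X p) ^t* + X p *m (derC v X p) ^t*).

Let derP v p : Omega p -> is_deriveCmx p v P (dP v p).
Proof.
move=> Op; rewrite -[dP v p]sub0r; apply: is_deriveCmxB; first exact: is_deriveCmx_cst.
by apply: is_deriveCmxM (derX v Op) _; exact: is_deriveCmx_adj (derX v Op).
Qed.

Lemma is_derive_proj v p : Omega p -> is_deriveCmx p v P (derC v P p).
Proof. by move=> Op; rewrite (derC_val (derP v Op)); exact: derP. Qed.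

(** Near p the first derivative of P is the expression [dP] in X and its derivative, which can be
    differentiated again. *)
Lemma is_derive2_proj v w p : Omega p ->
  is_deriveCmx p w (derC v P) (derC w (derC v P) p).
Proof.
move=> Op; have sX : smoothC_on Omega (derC v X).
  by case: solX => sX _ _; exact: smoothC_on_derC.
have dX := smoothC_on_is_derive w sX Op.
have d2 : is_deriveCmx p w (dP v) _ := is_deriveCmxN (is_deriveCmxD
  (is_deriveCmxM dX (is_deriveCmx_adj (derX w Op)))
  (is_deriveCmxM (derX w Op) (is_deriveCmx_adj dX))).
have d2' : is_deriveCmx p w (derC v P) _ := near_eq_is_deriveCmx _ d2.
rewrite (derC_val (d2' _)); first apply: d2'.
all: by apply: filterS (nearO Op) => y Oy; rewrite (derC_val (derP v Oy)).
Qed.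

(** Differentiate P P = P, which follows from X^† X = 1. *)
Lemma derC_proj_offdiag v p : Omega p ->
  derC v P p *m P p + P p *m derC v P p = derC v P p.
Proof.
move=> Op; have dp := is_derive_proj v Op.
apply: is_deriveCmx_unique (is_deriveCmxM dp dp) _.
apply: near_eq_is_deriveCmx dp; apply: filterS (nearO Op) => y Oy.
case: solX => _ /(_ y Oy) XX _; rewrite /proj_of.
rewrite mulmxBl mul1mx mulmxBr mulmx1 mulmxA -[X y *m _ *m X y]mulmxA XX mulmx1.
by rewrite subrr subr0.
Qed.

(** Differentiating -[dR P, P] gives -[dL dR P, P] - [dR P, dL P], and the first term vanishes by
    the Euler-Lagrange equation. *)
Lemma dL_dR_surface p : Omega p ->
  dL (dR Z) p = mxcomm (dL P p) (dR P p).
Proof.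
move=> Op; case: surfZ => _ _ _ ZR; case: solX => _ _ EL.
have d := is_deriveCmxN (is_deriveCmx_comm (is_derive2_proj (eR R) (eL R) Op)
  (is_derive_proj (eL R) Op)).
have {}d : is_deriveCmx p (eL R) (dR Z) _ := near_eq_is_deriveCmx _ d.
rewrite [LHS](derC_val (d _)); last first.
  by apply: filterS (nearO Op) => y Oy; rewrite ZR.
by rewrite [X in - (X + _)]EL // add0r /mxcomm opprB.
Qed.

Lemma dL_dR_surface_normal p : Omega p ->
  su_dot (dL (dR Z) p) (dL Z p) = 0 /\ su_dot (dL (dR Z) p) (dR Z p) = 0.
Proof.
move=> Op; case: surfZ => _ _ ZL ZR; rewrite dL_dR_surface // ZL // ZR //.
have hL := derC_proj_offdiag (eL R) Op; have hR := derC_proj_offdiag (eR R) Op.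
split; first exact: su_dot_comm_projection hL hR.
by rewrite su_dotNr (su_dot_comm_projection (dR P p) hL hR) oppr0.
Qed.

End SigmaModel.

(** * The moving frame of the surface and its Gram matrix *)

Lemma unitmx_block2 (F : fieldType) (a b c d : F) : a * d - b * c != 0 ->
  (block_mx a%:M b%:M c%:M d%:M : 'M_(1 + 1)) \in unitmx.
Proof.
(* B is the adjugate of the 2 x 2 matrix. *)
move=> D0; pose B : 'M_(1 + 1) := block_mx d%:M (- b)%:M (- c)%:M a%:M.
suff /mulmx1_unit[] : block_mx a%:M b%:M c%:M d%:M *m ((a * d - b * c)^-1 *: B) = 1%:M.
  by [].
have E (x y z w : F) :
    x%:M *m y%:M + z%:M *m w%:M = (x * y + z * w)%:M :> 'M_1.
  by rewrite -!scalar_mxM -raddfD.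
have [e1 e2 e3 e4] : [/\ a * d + b * - c = a * d - b * c, a * - b + b * a = 0,
    c * d + d * - c = 0 & c * - b + d * a = a * d - b * c] by split; ring.
rewrite -scalemxAr mulmx_block !E e1 e2 e3 e4.
by rewrite raddf0 -scalar_mx_block scale_scalar_mx mulVf.
Qed.

Section MovingFrame.
Variables (R : realType) (N k : nat).
Variables (Z : plane R -> 'M[R[i]]_N) (nv : 'I_k -> plane R -> 'M[R[i]]_N).

(** The positions of the two tangent vectors in [tau]; the nested shifts mirror the nested blocks of
    [U_mx] and [V_mx]. *)
Definition iL : 'I_(1 + 1 + k) := lshift k (lshift 1 ord0).
Definition iR : 'I_(1 + 1 + k) := lshift k (rshift 1 ord0).

Lemma tau_iL : tau Z nv iL = dL Z.
Proof. by rewrite /tau /iL (unsplitK (inl _)) (unsplitK (inl _)). Qed.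

Lemma tau_iR : tau Z nv iR = dR Z.
Proof. by rewrite /tau /iR (unsplitK (inl _)) (unsplitK (inr _)). Qed.

Lemma tau_normal j : tau Z nv (rshift (1 + 1) j) = nv j.
Proof. by rewrite /tau (unsplitK (inr _)). Qed.

Lemma tau_ind (Q : 'I_(1 + 1 + k) -> Prop) :
  Q iL -> Q iR -> (forall j, Q (rshift (1 + 1) j)) -> forall i, Q i.
Proof.
move=> QL QR Qn i; case: (split_ordP i) => [a|j] -> //.
by case: (split_ordP a) => b ->; rewrite [b]ord1.
Qed.

End MovingFrame.

Section GaussWeingarten.
Variables (R : realType) (N k : nat) (Ups : set (plane R)).
Variables (Z : plane R -> 'M[R[i]]_N) (nv : 'I_k -> plane R -> 'M[R[i]]_N).
Hypothesis openU : open Ups.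
Hypothesis Z_smooth : smoothC_on Ups Z.
Hypothesis Z_su : forall p, Ups p -> is_su (Z p).
Hypothesis detG_neq0 : forall p, Ups p -> detG Z p != 0.
Hypothesis frame : moving_frame Ups Z nv.

Lemma tau_smooth i : smoothC_on Ups (tau Z nv i).
Proof.
case: frame => sn _ _ _ _.
by elim/tau_ind: i => [||j]; rewrite ?tau_iL ?tau_iR ?tau_normal //;
  exact: smoothC_on_derC.
Qed.

Let derZ_su v p : Ups p -> is_su (derC v Z p).
Proof.
move=> Up; apply: is_su_derive (smoothC_on_is_derive v Z_smooth Up).
by apply: filterS Z_su _; exact: open_nbhs_nbhs.
Qed.

Lemma tau_su i p : Ups p -> is_su (tau Z nv i p).
Proof.
case: frame => _ sn _ _ _ Up.
by elim/tau_ind: i => [||j]; rewrite ?tau_iL ?tau_iR ?tau_normal;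
  [exact: derZ_su|exact: derZ_su|exact: sn].
Qed.

(** The normals are orthonormal and orthogonal to the tangent vectors, so only the first fundamental
    form remains, as the upper left block. *)
Let gramE p : Ups p -> gram (fun j => tau Z nv j p) = block_mx
  (block_mx (complex.Re (J_L Z p))%:M (complex.Re (G_LR Z p))%:M
            (complex.Re (G_LR Z p))%:M (complex.Re (J_R Z p))%:M) 0 0 1%:M.
Proof.
case: frame => _ _ nL nR nn Up; apply/matrixP => i j; rewrite mxE.
elim/tau_ind: i => [||i]; elim/tau_ind: j => [||j]; rewrite ?tau_iL ?tau_iR ?tau_normal.
- by rewrite block_mxEul block_mxEul mxE eqxx.
- by rewrite block_mxEul block_mxEur mxE eqxx.
- by rewrite block_mxEur mxE nL.
- by rewrite block_mxEul block_mxEdl mxE eqxx su_dotC.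
- by rewrite block_mxEul block_mxEdr mxE eqxx.
- by rewrite block_mxEur mxE nR.
- by rewrite block_mxEdl mxE su_dotC nL.
- by rewrite block_mxEdl mxE su_dotC nR.
- by rewrite block_mxEdr mxE nn //; case: eqP.
Qed.

(** The determinant reduces to that of the tangent block, whose image in the complex numbers is
    [detG]. *)
Lemma gram_tau_unit p : Ups p -> gram (fun j => tau Z nv j p) \in unitmx.
Proof.
move=> Up; have suL := derZ_su (eL R) Up; have suR := derZ_su (eR R) Up.
rewrite unitmxE gramE // det_ublock det1 mulr1 -unitmxE; apply: unitmx_block2.
have JL : J_L Z p = (complex.Re (J_L Z p))%:C := su_dot_real suL suL.
have JR : J_R Z p = (complex.Re (J_R Z p))%:C := su_dot_real suR suR.
have GLR : G_LR Z p = (complex.Re (G_LR Z p))%:C := su_dot_real suL suR.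
apply: contraNneq (detG_neq0 Up) => e0.
by rewrite /detG JL JR GLR -rmorphM -rmorphXn -rmorphB /= expr2 e0.
Qed.

Let unitG := gram_tau_unit.

(** The row of scalar products is supported on the normal indices, where the Gram matrix is the
    identity, so the inverse Gram matrix fixes it. *)
Lemma dot_row_normal p (W : 'M[R[i]]_N) : Ups p ->
  su_dot W (dL Z p) = 0 -> su_dot W (dR Z p) = 0 ->
  let x := dot_row (fun j => tau Z nv j p) W *m invmx (gram (fun j => tau Z nv j p)) in
  x 0 (iL k) = 0 /\ x 0 (iR k) = 0.
Proof.
move=> Up WL WR x; set y := dot_row _ W in x *.
have yE : y = row_mx 0 (rsubmx y).
  rewrite -[LHS]hsubmxK; congr row_mx; apply/rowP => a; rewrite !mxE.
  case: (split_ordP a) => b ->; rewrite [b]ord1 -/(iL k) -/(iR k).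
    by rewrite tau_iL WL.
  by rewrite tau_iR WR.
have xE : x = y.
  apply: (canLR (mulmxK (unitG Up))).
  by rewrite gramE // {2}yE mul_row_block !mul0mx mulmx0 mulmx1 !add0r -yE.
by rewrite xE yE /iL /iR !row_mxEl !mxE.
Qed.

End GaussWeingarten.

(** * Gauss-Weingarten coefficients read off connection matrices *)

Section ConnectionCoefficients.
Variables (R : realType) (k : nat).
Variables U V : plane R -> 'M[R]_(1 + 1 + k).
Local Notation nrm j := (rshift (1 + 1) j).

(** [H_] is taken from the second row of U; that the first row of V repeats it is a hypothesis of
    [V_mx_gw_of_mx]. *)
Definition gw_of_mx : gw_coeffs R k := GWCoeffs
  (fun p => U p (iL k) (iL k)) (fun p => U p (iL k) (iR k))
  (fun p => V p (iR k) (iL k)) (fun p => V p (iR k) (iR k))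
  (fun p => \row_j U p (iL k) (nrm j)) (fun p => \row_j V p (iR k) (nrm j))
  (fun p => \row_j U p (iR k) (nrm j))
  (fun p => \col_j U p (nrm j) (iL k)) (fun p => \col_j U p (nrm j) (iR k))
  (fun p => drsubmx (U p))
  (fun p => \col_j V p (nrm j) (iL k)) (fun p => \col_j V p (nrm j) (iR k))
  (fun p => drsubmx (V p)).

Lemma U_mx_gw_of_mx p : U p (iR k) (iL k) = 0 -> U p (iR k) (iR k) = 0 ->
  U_mx gw_of_mx p = U p.
Proof.
move=> URL URR; apply/matrixP => i j.
elim/tau_ind: i => [||i]; elim/tau_ind: j => [||j]; rewrite /U_mx /=.
- by rewrite block_mxEul block_mxEul mxE eqxx.
- by rewrite block_mxEul block_mxEur mxE eqxx.
- by rewrite block_mxEur col_mxEu mxE.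
- by rewrite block_mxEul block_mxEdl mxE.
- by rewrite block_mxEul block_mxEdr mxE.
- by rewrite block_mxEur col_mxEd mxE.
- by rewrite block_mxEdl row_mxEl mxE.
- by rewrite block_mxEdl row_mxEr mxE.
- by rewrite block_mxEdr !mxE.
Qed.

Lemma V_mx_gw_of_mx p : U p (iR k) (iL k) = 0 -> U p (iR k) (iR k) = 0 ->
  row (iL k) (V p) = row (iR k) (U p) -> V_mx gw_of_mx p = V p.
Proof.
move=> URL URR /rowP VU.
have {}VU j : V p (iL k) j = U p (iR k) j by have := VU j; rewrite !mxE.
apply/matrixP => i j.
elim/tau_ind: i => [||i]; elim/tau_ind: j => [||j]; rewrite /V_mx /=.
- by rewrite block_mxEul block_mxEul mxE VU.
- by rewrite block_mxEul block_mxEur mxE VU.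
- by rewrite block_mxEur col_mxEu mxE VU.
- by rewrite block_mxEul block_mxEdl mxE eqxx.
- by rewrite block_mxEul block_mxEdr mxE eqxx.
- by rewrite block_mxEur col_mxEd mxE.
- by rewrite block_mxEdl row_mxEl mxE.
- by rewrite block_mxEdl row_mxEr mxE.
- by rewrite block_mxEdr !mxE.
Qed.

End ConnectionCoefficients.

(** * Existence of the coefficients and the Gauss-Codazzi-Ricci equations *)

Theorem mainTheorem4 (R : realType) (m n : nat) (Omega : set (plane R))
    (X : plane R -> 'M[R[i]]_(m + n, m)) (Z : plane R -> 'M[R[i]]_(m + n))
    (p0 : plane R) (Ups : set (plane R))
    (nv : 'I_((m + n) ^ 2 - 3) -> plane R -> 'M[R[i]]_(m + n)) :
  (1 <= m)%N -> (1 <= n)%N ->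
  open Omega -> connected Omega -> simply_connected Omega ->
  sigma_solution Omega X ->
  associated_surface Omega X Z ->
  open_nbhs p0 Ups -> Ups `<=` Omega ->
  (forall p, Ups p -> detG Z p != 0) ->
  moving_frame Ups Z nv ->
  (exists c, gauss_weingarten Ups Z nv c) /\
  (forall c, gauss_weingarten Ups Z nv c -> gauss_codazzi_ricci Ups c).
Proof.
move=> m1 n1 openO _ _ solX surfZ [openU _] UO detG0 frame.
have [sZ suZ _ _] := surfZ.
have sZU : smoothC_on Ups Z := smoothC_onS UO sZ.
have suZU p : Ups p -> is_su (Z p) by move=> /UO; exact: suZ.
(* The subtraction of 3 is truncated; m, n >= 1 give (m + n)^2 >= 4, so the frame really has N^2 - 1
   members. *)
have dE : (1 + 1 + ((m + n) ^ 2 - 3) + 1 = (m + n) * (m + n))%N.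
  rewrite addnAC -[(1 + 1 + 1)%N]/3%N subnKC ?mulnn // (@leq_trans (2 ^ 2)) //.
  by rewrite leq_sqr (leq_add m1 n1).
have ts := tau_smooth sZU frame.
have tsu := tau_su openU sZU suZU frame.
have gu := gram_tau_unit openU sZU suZU detG0 frame.
set U := connection (tau Z nv) (eL R); set V := connection (tau Z nv) (eR R).
split.
  have rE (M : 'M[R]_(1 + 1 + ((m + n) ^ 2 - 3))) a b : row a M 0 b = M a b.
    by rewrite mxE.
  have rowU p i : row i (U p) = dot_row (fun j => tau Z nv j p) (dL (tau Z nv i) p)
      *m invmx (gram (fun j => tau Z nv j p)) by rewrite row_mul rowK.
  have rowV p i : row i (V p) = dot_row (fun j => tau Z nv j p) (dR (tau Z nv i) p)
      *m invmx (gram (fun j => tau Z nv j p)) by rewrite row_mul rowK.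
  (* These rows are the coordinates of dR dL Z and dL dR Z, which coincide. *)
  have VU p : Ups p -> row (iL _) (V p) = row (iR _) (U p).
    move=> Up; have ZC : dR (dL Z) p = dL (dR Z) p.
      exact: derC_commute sZ (UO _ Up).
    by rewrite rowU rowV tau_iL tau_iR ZC.
  (* The mixed derivative of Z is normal to the surface, so its tangential coordinates vanish. *)
  have U0 p : Ups p -> U p (iR _) (iL _) = 0 /\ U p (iR _) (iR _) = 0.
    move=> Up; have [WL WR] := dL_dR_surface_normal openO solX surfZ (UO _ Up).
    have := dot_row_normal openU sZU suZU detG0 frame Up WL WR.
    by have := rowU p (iR _); rewrite tau_iR /= => <-; rewrite !rE.
  exists (gw_of_mx U V) => p Up i.
  have [U1 U2] := U0 p Up.
  rewrite (U_mx_gw_of_mx _ U1 U2) (V_mx_gw_of_mx U1 U2 (VU p Up)).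
  by split; exact: (derC_frame dE openU ts tsu gu).
move=> c gw p Up.
(* Uniqueness of coordinates identifies any admissible coefficients with the connection matrices. *)
have UE y : Ups y -> U y = U_mx c y.
  by move=> Uy; apply/esym/(connection_unique tsu gu) => // i; have [] := gw y Uy i.
have VE y : Ups y -> V y = V_mx c y.
  by move=> Uy; apply/esym/(connection_unique tsu gu) => // i; have [] := gw y Uy i.
(* Derivatives can be transferred only through equality on a neighborhood, provided by the openness
   of [Ups]. *)
have nU : \forall y \near p, U y = U_mx c y.
  by apply: filterS UE _; exact: open_nbhs_nbhs.
have nV : \forall y \near p, V y = V_mx c y.
  by apply: filterS VE _; exact: open_nbhs_nbhs.
split.
- exact: near_eq_derivable nU (derivable_connection openU ts gu Up).
- exact: near_eq_derivable nV (derivable_connection openU ts gu Up).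
- have subst (A A' B B' C C' E E' : 'M[R]_(1 + 1 + ((m + n) ^ 2 - 3))) :
      A = A' -> B = B' -> C = C' -> E = E' ->
      A - B + mxcomm C E = 0 -> A' - B' + mxcomm C' E' = 0.
    by move=> -> -> -> ->.
  exact (subst _ _ _ _ _ _ _ _ (near_eq_derive (eR R) nU) (near_eq_derive (eL R) nV)
    (UE p Up) (VE p Up) (connection_flat dE openU ts tsu gu (eL R) (eR R) Up)).
Qed.
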